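(* Consider the $2^3$ main-effects model, with all weights $w_i>0$. (a) Suppose $\beta_1=0$ (which implies $w_1=w_5$, $w_2=w_6$, $w_3=w_7$, $w_4=w_8$). The regular fractions $\{1,4,6,7\}$ and $\{2,3,5,8\}$ are D-optimal within the class of half-fractions if and only if $$4\min\{w_1,w_2,w_3,w_4\}\ge\max\{w_1,w_2,w_3,w_4\}.$$ (b) Suppose $\beta_1=\beta_2=0$ (thus $w_1=w_3=w_5=w_7$ and $w_2=w_4=w_6=w_8$). The two regular half-fractions $\{1,4,6,7\}$ and $\{2,3,5,8\}$ are D-optimal half-fractions if and only if $4\min\{w_1,w_2\}\ge\max\{w_1,w_2\}$.
   Context: The $2^3$ main-effects model has linear predictor $\eta=\beta_0+\beta_1x_1+\beta_2x_2+\beta_3x_3$ with $x_j\in\{-1,1\}$. The model matrix $X$ is the $8\times4$ matrix with rows $(1,x_1,x_2,x_3)$ in the order row 1: $(1,1,1,1)$; row 2: $(1,1,1,-1)$; row 3: $(1,1,-1,1)$; row 4: $(1,1,-1,-1)$; row 5: $(1,-1,1,1)$; row 6: $(1,-1,1,-1)$; row 7: $(1,-1,-1,1)$; row 8: $(1,-1,-1,-1)$. The weights are $w_i=\nu(\eta_i)$, where $\eta_i=\mathbf x_i'\boldsymbol\beta$, $\mathbf x_i'$ is the $i$th row of $X$, $\boldsymbol\beta=(\beta_0,\beta_1,\beta_2,\beta_3)'$, and for a link function $g$, $\nu=[(g^{-1})']^2/[g^{-1}(1-g^{-1})]$ (only the resulting values $w_i$ matter). For an allocation $\mathbf p=(p_1,\dots,p_8)'$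 with $p_i\ge0$, $\sum p_i=1$, put $W=\mathrm{diag}\{w_1p_1,\dots,w_8p_8\}$; the D-criterion is the determinant $|X'WX|$. The half-fraction $\{i_1,i_2,i_3,i_4\}$ (four distinct indices in $\{1,\dots,8\}$) is the design with $p_{i_1}=p_{i_2}=p_{i_3}=p_{i_4}=1/4$ and all other $p_i=0$. A half-fraction is D-optimal within the class of half-fractions (a D-optimal half-fraction) if it maximizes $|X'WX|$ among all half-fractions. *)

(* Defs.v *)
From mathcomp Require Import all_boot all_order all_algebra.
From mathcomp Require Import all_classical all_reals all_analysis.
Set Implicit Arguments.
Unset Strict Implicit.
Unset Printing Implicit Defensive.
Import Order.TTheory GRing.Theory Num.Theory.
Import numFieldNormedType.Exports.
Local Open Scope ring_scope.

(* Design points are numbered from 1 to 8, 'I_8 counts from 0. *)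
Definition run (k : nat) : 'I_8 := inord k.-1.

Definition model_rows (R : realType) : seq (seq R) :=
  [:: [:: 1;  1;  1;  1];
      [:: 1;  1;  1; -1];
      [:: 1;  1; -1;  1];
      [:: 1;  1; -1; -1];
      [:: 1; -1;  1;  1];
      [:: 1; -1;  1; -1];
      [:: 1; -1; -1;  1];
      [:: 1; -1; -1; -1]].

Definition model_matrix (R : realType) : 'M[R]_(8, 4) :=
  \matrix_(i, j) nth 0 (nth [::] (model_rows R) i) j.

(* A link for a binary response has domain ]0, 1[. The inverse is a total
   function; only its values at the linear predictors enter the weights, and
   its values off the range of g are left unspecified. *)
Definition link_inverse (R : realType) (g ginv : R -> R) : Prop :=
  forall mu : R, 0 < mu < 1 -> ginv (g mu) = mu.

(* If ginv is not differentiable at eta, or takes the value 0 or 1 there, the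
   library's conventions for limits and inverses give nu ginv eta = 0, so
   0 < nu ginv eta excludes these cases; it also forces 0 < ginv eta < 1. *)
Definition nu (R : realType) (ginv : R -> R) (eta : R) : R :=
  (derive1 ginv eta) ^+ 2 / (ginv eta * (1 - ginv eta)).

Definition linear_predictor (R : realType) (beta : 'cV[R]_4) (i : 'I_8) : R :=
  (model_matrix R *m beta) i 0.

Definition weight (R : realType) (ginv : R -> R) (beta : 'cV[R]_4)
  (i : 'I_8) : R := nu ginv (linear_predictor beta i).

Definition D_criterion (R : realType) (w p : 'I_8 -> R) : R :=
  \det ((model_matrix R)^T *m diag_mx (\row_i (w i * p i)) *m model_matrix R).

Definition half_fraction_allocation (R : realType) (I : {set 'I_8})
  (i : 'I_8) : R := if i \in I then 1 / 4 else 0.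

Definition D_optimal_half_fraction (R : realType) (w : 'I_8 -> R)
  (I : {set 'I_8}) : Prop :=
  #|I| = 4%N /\
  forall J : {set 'I_8}, #|J| = 4%N ->
    D_criterion w (half_fraction_allocation R J) <=
    D_criterion w (half_fraction_allocation R I).

Lemma nu_gt0 (R : realType) (ginv : R -> R) (eta : R) :
  0 < nu ginv eta -> derivable ginv eta 1 /\ 0 < ginv eta < 1.
Proof.
rewrite /nu => h.
have d0 : derive1 ginv eta != 0.
  by apply/eqP => e; move: h; rewrite e expr0n mul0r ltxx.
split.
  apply: contrapT => nd; move/eqP: d0; apply.
  rewrite derive1E /derive; exact: dvgP.
have d2 : 0 < derive1 ginv eta ^+ 2 by rewrite exprn_even_gt0.
move: h; rewrite pmulr_rgt0 // invr_gt0 => h.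
have [g0|g0] := ltP 0 (ginv eta).
  by move: h; rewrite pmulr_rgt0 // subr_gt0.
move: h; rewrite ltNge mulr_le0_ge0 // subr_ge0.
by rewrite (le_trans g0).
Qed.

(* Main.v *)
Require Import Defs.
From mathcomp Require Import all_boot all_order all_algebra.
From mathcomp Require Import all_classical all_reals all_analysis.
From mathcomp Require Import zify lra.
Set Implicit Arguments.
Unset Strict Implicit.
Unset Printing Implicit Defensive.
Import Order.TTheory GRing.Theory Num.Theory.
Local Open Scope ring_scope.

(** The information matrix of a half-fraction J only involves the four rows of
    the model matrix indexed by J, so its determinant is
    4 ^- 4 * (det X_J)^2 * (the product of the weights over J), where X_J is the
    square matrix of these rows ([det_weighted_gram]).  Everything thus depends
    on how (det X_J)^2, which is 0, 64 or 256, interacts with the weights.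

    When beta_1 = 0 the weight of a run only depends on its cell, the pair
    (x2, x3); runs are grouped into four cells, and two runs share a cell when
    their numbers agree modulo 4.  Let u be the weight as a function of the
    cell, and P the product of the four values of u.  For a half-fraction J
    there are three possibilities ([level_det_cases]):
    - J meets every cell; its weights multiply to P and (det X_J)^2 <= 256,
      with equality for the two regular fractions;
    - J contains both runs of a cell a, misses a cell d, and takes one run in
      each other cell; its weights multiply to P * u a / u d, and
      (det X_J)^2 = 64;
    - J consists of two full cells; these four points lie in a plane, and
      det X_J = 0.
    Hence a regular fraction, of criterion 4 ^- 4 * 256 * P, beats all others
    as soon as u a <= 4 * u d for all cells a and d.  Conversely every pair
    a != d is realized by a half-fraction of the second kind
    ([level_det_collapsed]), so that the condition is also necessary.  It says
    that max u <= 4 * min u.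

    If moreover beta_2 = 0, then u only takes two values, and the condition
    for four weights becomes the one for two weights. *)

(** * Determinants supported on as many rows as columns *)

(** This is the Cauchy-Binet formula when a single minor contributes: dropping
    the rows of weight 0 from the Gram matrix leaves a product of three square
    matrices. *)
Lemma det_weighted_gram (R : comNzRingType) (m n : nat) (X : 'M[R]_(m, n))
    (t : n.-tuple 'I_m) (v : 'I_m -> R) :
  uniq t -> (forall i, i \notin t -> v i = 0) ->
  \det (X^T *m diag_mx (\row_i v i) *m X) =
  \det (rowsub (tnth t) X) ^+ 2 * \prod_(i <- t) v i.
Proof.
move=> t_uniq v0; pose Y := rowsub (tnth t) X.
have -> : X^T *m diag_mx (\row_i v i) *m X =
          Y^T *m diag_mx (\row_k v (tnth t k)) *m Y.
  apply/matrixP => a b; rewrite !mxE.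
  under eq_bigr => i _ do rewrite mul_mx_diag !mxE.
  under [RHS]eq_bigr => k _ do rewrite mul_mx_diag !mxE.
  rewrite -[RHS](big_tuple _ _ t predT (fun i => X i a * v i * X i b)) /=.
  rewrite (big_uniq _ t_uniq) /= [RHS]big_mkcond.
  by apply: eq_bigr => i _; case: ifPn => // /v0 ->; rewrite mulr0 mul0r.
rewrite !det_mulmx det_tr det_diag mulrAC -expr2 big_tuple.
by congr (_ * _); apply: eq_bigr => k _; rewrite mxE.
Qed.

(** Expansion along the first row, on entries given by a function of two
    natural numbers, so that determinants of integer matrices can be evaluated
    by computation. *)
Fixpoint laplace (n : nat) (A : nat -> nat -> int) : int :=
  if n isn't n'.+1 then 1 else
  foldr +%R 0 [seq A 0%N j * ((-1) ^+ j
    * laplace n' (fun i k => A i.+1 (bump j k))) | j <- iota 0 n].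

Lemma det_laplace (n : nat) (A : nat -> nat -> int) :
  \det (\matrix_(i < n, j < n) A i j) = laplace n A.
Proof.
elim: n A => [|n IHn] A; first by rewrite det_mx00.
have -> : laplace n.+1 A = \sum_(0 <= j < n.+1) A 0%N j * ((-1) ^+ j
    * laplace n (fun i k => A i.+1 (bump j k))).
  by rewrite /index_iota subn0 -[RHS](big_map _ predT id) -foldrE.
rewrite (expand_det_row _ ord0) big_mkord.
apply: eq_bigr => j _; rewrite mxE /cofactor add0n -IHn; congr (_ * (_ * \det _)).
by apply/matrixP => i k; rewrite !mxE.
Qed.

(** * The half-fractions of the two-level design *)

(** Writing a run number, counted from 0, in binary as b1 b2 b3, the factor x_j
    is (-1)^(b_j); the exponents below have the same parity as 0, b1, b2, b3. *)
Definition level (i j : nat) : int :=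
  (-1) ^+ nth 0%N [:: 0; i %/ 4; i %/ 2; i]%N j.

Lemma model_matrixE (R : realType) (i : 'I_8) (j : 'I_4) :
  model_matrix R i j = (level i j)%:~R.
Proof.
rewrite mxE; case: i j => [] [|[|[|[|[|[|[|[|i]]]]]]]] //= _.
all: case=> [] [|[|[|[|j]]]] //= _; by rewrite ?mulrN1z.
Qed.

Definition level_det (s : seq nat) : int :=
  laplace 4 (fun k j => level (nth 0%N s k) j).

Lemma det_model_rows (R : realType) (t : 4.-tuple 'I_8) :
  \det (rowsub (tnth t) (model_matrix R)) =
  (level_det [seq val i | i <- t])%:~R.
Proof.
rewrite /level_det -det_laplace -(det_map_mx (intmul 1)).
congr (\det _); apply/matrixP => k j; rewrite [LHS]mxE model_matrixE !mxE.
by rewrite (nth_map ord0) ?size_tuple // -tnth_nth.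
Qed.
(** Runs i and i + 4 differ in x1 only, so i %% 4 encodes (x2, x3). *)
Definition cells (s : seq nat) : seq nat := [seq (i %% 4)%N | i <- s].
(** The cells of s are the four cells with d removed and a put in its place;
    each cell occurs exactly once when a = d. *)
Definition replaces (s : seq nat) (d a : nat) : bool :=
  perm_eq (d :: cells s) (a :: iota 0 4).

(** The trichotomy of [level_det_cases], as a test. *)
Definition half_fraction_ok (s : seq nat) : bool :=
  [|| level_det s == 0,
      (level_det s ^+ 2 <= 256) && replaces s 0 0
    | (level_det s ^+ 2 == 64) &&
      has (fun a => has (fun d => replaces s d a) (iota 0 4)) (iota 0 4)].

(** The 70 half-fractions are listed by increasing run numbers. *)
Lemma half_fractions_ok :
  all (fun i => all (fun j => all (fun k => all (fun l =>
    half_fraction_ok [:: i; j; k; l])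
    (iota k.+1 (7 - k))) (iota j.+1 (7 - j))) (iota i.+1 (7 - i))) (iota 0 8).
Proof. by vm_compute. Qed.

Lemma level_det_cases (i j k l : nat) (s := [:: i; j; k; l]) :
  (i < j < k)%N -> (k < l < 8)%N ->
  [\/ level_det s = 0,
      level_det s ^+ 2 <= 256 /\ replaces s 0 0
    | level_det s ^+ 2 = 64 /\
      exists a d, [/\ (a < 4)%N, (d < 4)%N & replaces s d a]].
Proof.
case/andP=> ij jk /andP[kl l8].
have: half_fraction_ok s.
  have above x y : (x < y < 8)%N -> y \in iota x.+1 (7 - x).
    by move=> xy; rewrite mem_iota; lia.
  have i8 : i \in iota 0 8 by rewrite mem_iota; lia.
  move/allP: half_fractions_ok => /(_ i i8) /allP /(_ j).
  move=> /(_ (above i j ltac:(lia))) /allP /(_ k (above j k ltac:(lia))).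
  by move=> /allP /(_ l (above k l ltac:(lia))).
case/or3P.
- by move/eqP; constructor 1.
- by case/andP; constructor 2.
- case/andP=> /eqP ? /hasP[a + /hasP[d]]; rewrite !mem_iota => ? ? ?.
  by constructor 3; split=> //; exists a, d.
Qed.

(** Both runs of the cell a, and the runs with x1 = 1 of the two cells other
    than a and d. *)
Definition collapsed (a d : nat) : seq nat :=
  [:: a, (a + 4)%N & [seq c <- iota 0 4 | c \notin [:: a; d]]].

(** The points of [collapsed a d] span: those with x1 = 1 are three corners of a
    square, and the fourth point lies outside of their plane. *)
Lemma level_det_collapsed (a d : nat) (s := collapsed a d) :
  (a < 4)%N -> (d < 4)%N -> a != d ->
  [/\ size s = 4%N, uniq s, all (fun i => i < 8)%N s,
      level_det s ^+ 2 = 64 & replaces s d a].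
Proof.
rewrite /s; case: a {s} => [|[|[|[|a]]]] //; case: d => [|[|[|[|d]]]] // _ _ _.
all: by split; vm_compute.
Qed.

(** * The D-criterion when weights depend on the cell *)

(** Up to the factor 4 ^- 4, the D-criterion of the half-fraction with runs s
    when u gives the weight of each cell. *)
Definition cell_criterion (R : realType) (u : nat -> R) (s : seq nat) : R :=
  (level_det s)%:~R ^+ 2 * \prod_(c <- cells s) u c.

Lemma D_criterion_half_fraction (R : realType) (w : 'I_8 -> R) (u : nat -> R)
    (t : seq 'I_8) (J : {set 'I_8}) :
  (forall i, w i = u (i %% 4)%N) -> size t = 4%N -> uniq t -> J =i t ->
  D_criterion w (half_fraction_allocation R J) =
  4 ^- 4 * cell_criterion u [seq val i | i <- t].
Proof.
move=> wu t4 t_uniq Jt; pose t' := @Tuple 4 _ t (introT eqP t4).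
rewrite /D_criterion (@det_weighted_gram _ _ _ _ t') //; last first.
  by move=> i; rewrite /half_fraction_allocation Jt => /negPf ->; rewrite mulr0.
rewrite det_model_rows mulrCA; congr (_ * _).
rewrite /cells -map_comp big_map [RHS]mulrC -exprVn.
have -> : 4^-1 ^+ 4 = \prod_(i <- t) (4^-1 : R).
  by rewrite big_const_seq count_predT t4 iter_mulr_1.
rewrite -big_split; apply: eq_big_seq => i it /=.
by rewrite wu /half_fraction_allocation Jt it mul1r.
Qed.

Lemma replaces_prod (R : realType) (u : nat -> R) (s : seq nat) (d a : nat) :
  replaces s d a ->
  u d * \prod_(c <- cells s) u c = u a * \prod_(c <- iota 0 4) u c.
Proof.
rewrite /replaces => sda.
have : \prod_(c <- d :: cells s) u c = \prod_(c <- a :: iota 0 4) u c.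
  exact: perm_big.
by rewrite (big_cons _ _ d) (big_cons _ _ a).
Qed.

Lemma prod_cells_gt0 (R : realType) (u : nat -> R) :
  (forall c, (c < 4)%N -> 0 < u c) -> 0 < \prod_(c <- iota 0 4) u c.
Proof.
move=> u0; rewrite big_seq prodr_gt0 // => c; rewrite mem_iota => /andP[_ c4].
exact: u0.
Qed.

(** The factor 4 lost on a weight when a replaces d is the one gained on the
    squared determinant, 256 against 64. *)
Lemma cell_criterion_le (R : realType) (u : nat -> R) (i j k l : nat) :
  (forall c, (c < 4)%N -> 0 < u c) ->
  (forall a d, (a < 4)%N -> (d < 4)%N -> u a <= 4 * u d) ->
  (i < j < k)%N -> (k < l < 8)%N ->
  cell_criterion u [:: i; j; k; l] <= 256 * \prod_(c <- iota 0 4) u c.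
Proof.
move=> u0 u4 ijk kl8; set P := \prod_(c <- iota 0 4) u c.
have P0 : 0 < P := prod_cells_gt0 u0.
rewrite /cell_criterion -rmorphXn /=.
case: (level_det_cases ijk kl8) => [->|[det_le rep]|[-> [a [d [a4 d4 rep]]]]].
- rewrite expr0n /= mul0r; apply: mulr_ge0 (ltW P0); exact: ler0n.
- have -> : \prod_(c <- cells [:: i; j; k; l]) u c = P.
    by apply: (mulfI (lt0r_neq0 (u0 0%N _))) => //; exact: replaces_prod rep.
  by rewrite ler_pM2r // -[256]/(256%:~R) ler_int.
- (* Multiplied by u d, the bound reads 64 * (u a * P) <= u d * (256 * P). *)
  rewrite -(ler_pM2l (u0 d d4)) mulrCA (replaces_prod u rep) -/P.
  rewrite -[64%:~R]/(64 : R).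
  have := ler_wpM2r (ltW P0) (u4 a d a4 d4); lra.
Qed.

Lemma half_fraction_seq (J : {set 'I_8}) : #|J| = 4%N ->
  exists i j k l, [/\ [seq val x | x <- enum J] = [:: i; j; k; l],
    (i < j < k)%N & (k < l < 8)%N].
Proof.
move=> J4; have: sorted ltn [seq val x | x <- enum J].
  rewrite sorted_map /enum_mem sorted_filter //.
    by move=> x y z; exact: ltn_trans.
  by rewrite -sorted_map -enumT val_enum_ord iota_ltn_sorted.
move: J4; rewrite cardE.
case: (enum J) => [|i [|j [|k [|l [|? ?]]]]] //= _.
case/and4P=> ij jk kl _; exists i, j, k, l; split=> //; first by rewrite ij.
by rewrite kl /=.
Qed.

(** The condition is necessary because [collapsed a d] must not beat the
    fraction t, whose squared determinant attains the largest value 256. *)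
Lemma regular_optimalP (R : realType) (w : 'I_8 -> R) (u : nat -> R)
    (t : seq 'I_8) :
  (forall i, w i = u (i %% 4)%N) -> (forall c, (c < 4)%N -> 0 < u c) ->
  size t = 4%N -> uniq t -> level_det [seq val i | i <- t] ^+ 2 = 256 ->
  replaces [seq val i | i <- t] 0 0 ->
  D_optimal_half_fraction w [set i in t]%SET <->
  (forall a d, (a < 4)%N -> (d < 4)%N -> u a <= 4 * u d).
Proof.
move=> wu u0 t4 t_uniq det_t rep_t.
have memt : [set i in t]%SET =i t by move=> i; rewrite inE.
have q0 : 0 < 4 ^- 4 :> R by rewrite invr_gt0 exprn_gt0.
have D_t := D_criterion_half_fraction wu t4 t_uniq memt.
have C_t : cell_criterion u [seq val i | i <- t] =
    256 * \prod_(c <- iota 0 4) u c.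
  rewrite /cell_criterion -rmorphXn /= det_t; congr (_ * _).
  by apply: (mulfI (lt0r_neq0 (u0 0%N _))) => //; exact: replaces_prod rep_t.
rewrite /D_optimal_half_fraction D_t C_t; split=> [[_ opt] a d a4 d4|u4].
  have [->|ad] := eqVneq a d; first by have := u0 d d4; lra.
  have [s4 s_uniq s8 det_s rep_s] := level_det_collapsed a4 d4 ad.
  set s := collapsed a d in s4 s_uniq s8 det_s rep_s.
  pose t' : seq 'I_8 := [seq inord x | x <- s].
  have t's : [seq val i | i <- t'] = s.
    rewrite -map_comp -[RHS]map_id; apply/eq_in_map => x /(allP s8) x8 /=.
    by rewrite inordK.
  have t'_uniq : uniq t' by rewrite -(map_inj_uniq val_inj) t's.
  have t'4 : size t' = 4%N by rewrite size_map.
  have memt' : [set i in t']%SET =i t' by move=> i; rewrite inE.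
  have := opt [set i in t']%SET.
  rewrite (eq_card memt') (card_uniqP t'_uniq) t'4 => /(_ erefl).
  rewrite (D_criterion_half_fraction wu t'4 t'_uniq memt') t's ler_pM2l //.
  rewrite /cell_criterion -rmorphXn /= det_s -[64%:~R]/(64 : R).
  rewrite -(ler_pM2l (u0 d d4)) mulrCA (replaces_prod u rep_s).
  have := prod_cells_gt0 u0; set P := \prod_(c <- iota 0 4) u c => P0.
  by move=> le_s; rewrite -(ler_pM2r P0); lra.
split=> [|J J4]; first by rewrite (eq_card memt) (card_uniqP t_uniq).
have [i [j [k [l [Js ijk kl8]]]]] := half_fraction_seq J4.
rewrite (D_criterion_half_fraction (t := enum J) wu) ?enum_uniq -?cardE //.
  by rewrite Js ler_pM2l //; exact: cell_criterion_le.
by move=> x; rewrite mem_enum.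
Qed.

Lemma max4_le_4min4P (R : realType) (u : nat -> R) :
  (forall a d, (a < 4)%N -> (d < 4)%N -> u a <= 4 * u d) <->
  Num.max (Num.max (u 0%N) (u 1%N)) (Num.max (u 2%N) (u 3%N)) <=
  4 * Num.min (Num.min (u 0%N) (u 1%N)) (Num.min (u 2%N) (u 3%N)).
Proof.
rewrite !minr_pMr // !ge_max !le_min; split=> [u4|].
  by rewrite !u4.
move=> H [|[|[|[|a]]]] [|[|[|[|d]]]] // _ _; lra.
Qed.

(** * Inactive factors and the main theorem *)

Lemma weight_eq (R : realType) (ginv : R -> R) (beta : 'cV[R]_4) (i k : 'I_8) :
  (forall j : 'I_4, level i j != level k j -> beta j 0 = 0) ->
  weight ginv beta i = weight ginv beta k.
Proof.
move=> inactive; rewrite /weight; congr (nu _ _).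
rewrite /linear_predictor !mxE; apply: eq_bigr => j _; rewrite !model_matrixE.
by have [->//|/inactive->] := eqVneq (level i j) (level k j); rewrite !mulr0.
Qed.

Lemma forall_ord4 (P : 'I_4 -> Prop) :
  P 0 -> P 1 -> P 2 -> P 3 -> forall j, P j.
Proof.
move=> P0 P1 P2 P3 [[|[|[|[|j]]]] j4] //.
- by rewrite (_ : Ordinal j4 = 0) //; apply/val_inj.
- by rewrite (_ : Ordinal j4 = 1) //; apply/val_inj.
- by rewrite (_ : Ordinal j4 = 2) //; apply/val_inj.
- by rewrite (_ : Ordinal j4 = 3) //; apply/val_inj.
Qed.

Lemma runE (k : nat) : (0 < k < 9)%N -> run k = k.-1 :> nat.
Proof. by move=> k9; rewrite /run inordK //; lia. Qed.

Lemma weight_mod4 (R : realType) (ginv : R -> R) (beta : 'cV[R]_4)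
    (i k : 'I_8) :
  beta 1 0 = 0 -> (i = k %[mod 4])%N -> weight ginv beta i = weight ginv beta k.
Proof.
move=> beta1 ik; apply: weight_eq; apply: forall_ord4; rewrite ?beta1 //.
all: move: ik; case: i => [] [|[|[|[|[|[|[|[|i]]]]]]]] //= _.
all: by case: k => [] [|[|[|[|[|[|[|[|k]]]]]]]].
Qed.

Lemma weight_parity (R : realType) (ginv : R -> R) (beta : 'cV[R]_4)
    (i k : 'I_8) :
  beta 1 0 = 0 -> beta 2 0 = 0 -> odd i = odd k ->
  weight ginv beta i = weight ginv beta k.
Proof.
move=> beta1 beta2 ik; apply: weight_eq.
apply: forall_ord4; rewrite ?beta1 ?beta2 // /level /=.
by rewrite -signr_odd ik signr_odd eqxx.
Qed.

Lemma regular_pair_optimalP (R : realType) (w : 'I_8 -> R) (u : nat -> R) :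
  (forall i, w i = u (i %% 4)%N) -> (forall c, (c < 4)%N -> 0 < u c) ->
  D_optimal_half_fraction w [set run 1; run 4; run 6; run 7]%SET /\
  D_optimal_half_fraction w [set run 2; run 3; run 5; run 8]%SET <->
  Num.max (Num.max (u 0%N) (u 1%N)) (Num.max (u 2%N) (u 3%N)) <=
  4 * Num.min (Num.min (u 0%N) (u 1%N)) (Num.min (u 2%N) (u 3%N)).
Proof.
move=> wu u0.
have opt1 := @regular_optimalP R w u [:: run 1; run 4; run 6; run 7] wu u0.
have opt2 := @regular_optimalP R w u [:: run 2; run 3; run 5; run 8] wu u0.
have F1E : [set run 1; run 4; run 6; run 7]%SET =
    [set i in [:: run 1; run 4; run 6; run 7]]%SET.
  by apply/setP => i; rewrite !inE !orbA.
have F2E : [set run 2; run 3; run 5; run 8]%SET =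
    [set i in [:: run 2; run 3; run 5; run 8]]%SET.
  by apply/setP => i; rewrite !inE !orbA.
rewrite F1E F2E -max4_le_4min4P opt1 ?opt2 //=; first by split=> [[]|].
all: rewrite ?inE -?val_eqE /= !runE //; by vm_compute.
Qed.

Theorem theorem4p1p4 (R : realType) (g ginv : R -> R)
  (hg : link_inverse g ginv) (beta : 'cV[R]_4)
  (hw : forall i : 'I_8, 0 < weight ginv beta i) :
  let w := weight ginv beta in
  let w_ k := w (run k) in
  let F1 := [set run 1; run 4; run 6; run 7]%SET in
  let F2 := [set run 2; run 3; run 5; run 8]%SET in
  (beta 1 0 = 0 ->
     [/\ w_ 1%N = w_ 5%N, w_ 2%N = w_ 6%N, w_ 3%N = w_ 7%N & w_ 4%N = w_ 8%N]
     /\ ((D_optimal_half_fraction w F1 /\ D_optimal_half_fraction w F2) <->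
         Num.max (Num.max (w_ 1%N) (w_ 2%N)) (Num.max (w_ 3%N) (w_ 4%N)) <=
         4 * Num.min (Num.min (w_ 1%N) (w_ 2%N)) (Num.min (w_ 3%N) (w_ 4%N))))
  /\
  (beta 1 0 = 0 -> beta 2 0 = 0 ->
     [/\ w_ 1%N = w_ 3%N, w_ 3%N = w_ 5%N & w_ 5%N = w_ 7%N] /\
     [/\ w_ 2%N = w_ 4%N, w_ 4%N = w_ 6%N & w_ 6%N = w_ 8%N] /\
     ((D_optimal_half_fraction w F1 /\ D_optimal_half_fraction w F2) <->
      Num.max (w_ 1%N) (w_ 2%N) <= 4 * Num.min (w_ 1%N) (w_ 2%N))).
Proof.
move=> w w_ F1 F2; pose u c := w_ c.+1.
have u0 c : (c < 4)%N -> 0 < u c by move=> _; exact: hw.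
have w_mod4 : beta 1 0 = 0 -> forall i, w i = u (i %% 4)%N.
  move=> beta1 i; apply: weight_mod4 beta1 _.
  by rewrite runE ?modn_mod //; have := ltn_pmod i (d := 4); lia.
split=> [beta1|beta1 beta2].
  split; last exact: regular_pair_optimalP (w_mod4 beta1) u0.
  by split; apply: weight_mod4 beta1 _; rewrite !runE.
have w_odd k l : (0 < k < 9)%N -> (0 < l < 9)%N -> odd k.-1 = odd l.-1 ->
    w_ k = w_ l.
  by move=> k9 l9 kl; apply: weight_parity; rewrite ?runE.
do 2!(split; first by split; exact: w_odd).
rewrite (regular_pair_optimalP (w_mod4 beta1) u0) /u.
by rewrite -(w_odd 1 3)%N // -(w_odd 2 4)%N // maxxx minxx.
Qed.
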